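(* For all integers $k\geq 3$ and $n\geq \frac{9}{4}(k-2)(k^2-k)^2$, every permutation $p\in S_n$ has a $2$-additive subsequence of length $k$.
   Context: $S_n$ denotes the set of permutations of $\{1,2,\ldots,n\}$ written in one-line notation $p=(p_1,p_2,\ldots,p_n)$. A subsequence of $p$ of length $k$ is a sequence $(p_{i_1},\ldots,p_{i_k})$ with $i_1<\cdots<i_k$. A sequence $(a_1,a_2,\ldots,a_k)$ of positive integers is $2$-additive if $a_1+a_2+\cdots+a_k=2a_1$ or $a_1+a_2+\cdots+a_k=2a_k$. *)

(* Defs.v *)
From mathcomp Require Import all_boot all_order all_fingroup all_algebra.

Set Implicit Arguments.
Unset Strict Implicit.
Unset Printing Implicit Defensive.

(* ['S_n] permutes {0, .., n-1}; the shift by one gives the usual values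
   {1, .., n}. *)
Definition one_line (n : nat) (p : 'S_n) : seq nat :=
  [seq (p i).+1 | i <- enum 'I_n].

(* The default 0 of [head] and [last] is only reached on the empty sequence. *)
Definition two_additive (a : seq nat) : bool :=
  (sumn a == 2 * head 0 a) || (sumn a == 2 * last 0 a).

(* Main.v *)
Require Import Defs.
From mathcomp Require Import all_boot all_order all_fingroup all_algebra.
From mathcomp Require Import zify ring lra.
From Stdlib Require Import Classical.
Import Order.TTheory GRing.Theory Num.Theory.
Local Open Scope ring_scope.

(** Suppose that [p] has no 2-additive subsequence of length [k]. Then no value
    is the sum of [k - 1] distinct values that all stand on the same side of it.

    Near either end of [p] this is very restrictive. A value [v] among the first
    [k - 2], together with its predecessors, makes at most [k - 2] integers, and
    if [v] exceeds [B = 2 (k - 1) (k - 2)] it is a sum of [k - 1] distinct positive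
    integers other than these ([exists_sum_avoiding]), all of which follow [v]. So
    the first [k - 2] values are at most [B] ([prefix_small]), and by reversal so
    are the last [k - 2].

    Let [D1] and [D2] be the sums of the first and of the last [k - 2] values. If
    [w > B] and [w + D1] stood after [w], it would be the sum of [w] and the first
    [k - 2] values, all before it. So [w + D1] always precedes [w]
    ([shift_precedes]); by reversal [w - D2] precedes [w] when [w - D2 > B].
    Now the interval [(B, B + D1 + D2]] has length [D1 + D2], so from each of its
    points one of the steps [+ D1], [- D2] stays inside it: none of its members
    can stand first in [p]. This is absurd once [n >= B + D1 + D2], and
    [D1, D2 <= (k - 2) B] makes [n >= (2 k - 3) B], of order [4 k^3], sufficient;
    the assumed bound is of order [k^5]. *)

(** * Sums of distinct integers avoiding a finite set *)

Lemma exists_image_avoiding (F : seq nat) (g : nat -> nat) :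
    {in iota 1 (size F).+1 &, injective g} ->
  exists2 a, (0 < a <= (size F).+1)%N & g a \notin F.
Proof.
move=> g_inj.
case: (boolP (all (fun a => g a \in F) (iota 1 (size F).+1))) => [/allP gF|].
  have sub : {subset map g (iota 1 (size F).+1) <= F}.
    by move=> _ /mapP[a ain ->]; exact: gF.
  have := uniq_leq_size _ sub.
  rewrite map_inj_in_uniq // iota_uniq size_map size_iota ltnn.
  by move=> /(_ isT).
move=> /allPn[a]; rewrite mem_iota => abound gaF.
by exists a => //; lia.
Qed.

(** Some positive [a <= size F + 1] is outside [F]; subtracting it from [v] and
    adding it to [F] leaves the same problem with one summand less. The last
    two summands come together, as a pair [a], [v - a]: the pairs with
    [a <= size F + 1] are disjoint, so one of them misses [F]. *)
Lemma exists_sum_avoiding (m : nat) (F : seq nat) (v : nat) :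
    (m.+2 * (size F + m.+1) < v)%N ->
  exists s, [/\ uniq s, size s = m.+2, sumn s = v &
    {in s, forall x, (0 < x)%N && (x \notin F)}].
Proof.
elim: m F v => [|m IHm] F v v_large.
  pose g a := if a \in F then a else (v - a)%N.
  have g_inj : {in iota 1 (size F).+1 &, injective g}.
    move=> a b; rewrite !mem_iota /g => abound bbound.
    by case: ifP => aF; case: ifP => bF; lia.
  have [a abound] := exists_image_avoiding F g g_inj.
  rewrite /g; case: ifPn => [-> //|aF vaF].
  exists [:: a; (v - a)%N]; split => //=.
  - by rewrite inE andbT; lia.
  - lia.
  - by move=> x; rewrite !inE => /orP[] /eqP->; rewrite ?aF ?vaF andbT; lia.
have [a abound aF] := exists_image_avoiding F id (in2W (@inj_id nat)).
have [|s [s_uniq s_size s_sum s_avoids]] := IHm (a :: F) (v - a)%N.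
  by rewrite /=; nia.
exists (a :: s); split => /=.
- rewrite s_uniq andbT; apply/negP => /s_avoids.
  by rewrite inE eqxx andbF.
- by rewrite s_size.
- by rewrite s_sum; nia.
- move=> x; rewrite inE => /orP[/eqP->|/s_avoids]; first by rewrite aF; lia.
  by rewrite inE negb_or => /and3P[-> _ ->].
Qed.

(** * Additive subsequences and reversal *)

Definition has_additive (k : nat) (L : seq nat) :=
  exists s, [/\ subseq s L, size s = k & two_additive s].

Lemma has_additive_rev (k : nat) (L : seq nat) :
  has_additive k (rev L) -> has_additive k L.
Proof.
move=> [s [s_sub s_size s_add]]; exists (rev s); split.
- by rewrite -[L]revK subseq_rev.
- by rewrite size_rev.
- move: s_add; rewrite /two_additive sumn_rev orbC.
  congr (_ || _); congr (_ == 2 * _)%N.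
    by case: (lastP s) => // t x; rewrite last_rcons rev_rcons.
  by case: s {s_sub s_size} => // x t; rewrite rev_cons last_rcons.
Qed.

Lemma index_rev (T : eqType) (s : seq T) (x : T) :
  uniq s -> x \in s -> index x (rev s) = (size s - (index x s).+1)%N.
Proof.
move=> s_uniq xs.
have x_lt : (index x s < size s)%N by rewrite index_mem.
have rev_idx : (size s - (index x s).+1 < size (rev s))%N.
  by rewrite size_rev; lia.
rewrite -[RHS](index_uniq x rev_idx) ?rev_uniq // nth_rev; last by lia.
have -> : (size s - (size s - (index x s).+1).+1 = index x s)%N by lia.
by rewrite nth_index.
Qed.

(** Sorting a set of entries into the order of [L] changes neither its size nor
    its sum, so only the positions relative to [v] matter. *)
Lemma additive_of_later_sum (L S : seq nat) (v : nat) :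
    uniq L -> v \in L -> uniq S ->
    {in S, forall x, (x \in L) && (index v L < index x L)%N} -> sumn S = v ->
  has_additive (size S).+1 L.
Proof.
move=> L_uniq v_L; case/splitPr: v_L L_uniq => L1 L2.
rewrite cat_uniq /= negb_or => /and4P[_ /andP[v_L1 _] v_L2 L2_uniq].
move=> S_uniq S_later S_sum.
have S_L2 : {subset S <= L2}.
  move=> x /S_later; rewrite mem_cat inE !index_cat (negPf v_L1) /= eqxx addn0.
  case: ifP => [x_L1 /= x_v|_ /=].
    by move: x_v; rewrite ltnNge ltnW // index_mem.
  by case: (eqVneq x v) => [->|_ /andP[]//] /=; rewrite addn0 ltnn.
have S_perm : perm_eq (filter (mem S) L2) S.
  apply: uniq_perm; rewrite ?filter_uniq // => x.
  by rewrite mem_filter; apply: andb_idr; exact: S_L2.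
exists (v :: filter (mem S) L2); split.
- apply: subseq_trans (suffix_subseq L1 _).
  by rewrite /= eqxx filter_subseq.
- by rewrite /= (perm_size S_perm).
- by rewrite /two_additive /= (perm_sumn S_perm) S_sum; apply/orP; left; lia.
Qed.

Lemma additive_of_earlier_sum (L S : seq nat) (v : nat) :
    uniq L -> v \in L -> uniq S ->
    {in S, forall x, (x \in L) && (index x L < index v L)%N} -> sumn S = v ->
  has_additive (size S).+1 L.
Proof.
move=> L_uniq v_L S_uniq S_earlier S_sum; apply: has_additive_rev.
apply: (additive_of_later_sum _ S v); rewrite ?rev_uniq ?mem_rev //.
move=> x /S_earlier/andP[x_L x_v]; rewrite mem_rev x_L !index_rev //=.
have v_lt : (index v L < size L)%N by rewrite index_mem.
lia.
Qed.

(** * Arrangements without additive subsequences *)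

Definition arrangement (n : nat) (L : seq nat) :=
  uniq L /\ forall x, (x \in L) = (0 < x <= n)%N.

Lemma arrangement_rev (n : nat) (L : seq nat) :
  arrangement n L -> arrangement n (rev L).
Proof.
by move=> [L_uniq L_mem]; split=> [|x]; rewrite ?rev_uniq ?mem_rev.
Qed.

Lemma arrangement_size (n : nat) (L : seq nat) :
  arrangement n L -> size L = n.
Proof.
move=> [L_uniq L_mem]; rewrite -(size_iota 1 n); apply: perm_size.
by apply: uniq_perm; rewrite ?iota_uniq // => x; rewrite L_mem mem_iota; lia.
Qed.

Lemma arrangement_one_line (n : nat) (p : 'S_n) : arrangement n (one_line p).
Proof.
split=> [|x].
  rewrite map_inj_in_uniq ?enum_uniq // => i j _ _ [] /val_inj.
  exact: perm_inj.
apply/mapP/idP => [[i _ ->] /=|]; first exact: ltn_ord.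
case: x => // x /= x_lt; exists (p^-1%g (Ordinal x_lt)); first by rewrite mem_enum.
by rewrite permKV.
Qed.

(** The bound of [exists_sum_avoiding] for [k - 1] summands and [k - 2] excluded
    integers, where [k = m + 3]. *)
Definition small_bound (m : nat) : nat := (m.+2 * (m.+1 + m.+1))%N.

(** The excluded integers are [x] and its predecessors, so that all summands
    found stand after [x]. *)
Lemma prefix_small (m n : nat) (L : seq nat) :
    arrangement n L -> ~ has_additive m.+3 L ->
  {in take m.+1 L, forall x, (x <= small_bound m)%N}.
Proof.
move=> [L_uniq L_mem] no_add x x_pre; rewrite leqNgt; apply/negP => x_large.
have x_L : x \in L := mem_take x_pre.
have x_idx : (index x L < m.+1)%N by rewrite -in_take.
pose F := take (index x L).+1 L.
have F_size : (size F <= m.+1)%N by rewrite size_take_min; lia.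
have [|S [S_uniq S_size S_sum S_avoids]] := exists_sum_avoiding m F x.
  apply: leq_trans x_large; rewrite ltnS leq_mul2l leq_add2r F_size.
  by rewrite orbT.
apply: no_add; rewrite -S_size.
apply: (additive_of_later_sum _ _ x) => // y y_S.
have /andP[y_gt0 y_F] := S_avoids y y_S.
have y_L : y \in L.
  have := perm_sumn (perm_to_rem y_S); rewrite /= S_sum.
  by move: x_L; rewrite !L_mem; lia.
by move: y_F; rewrite y_L in_take // -leqNgt.
Qed.

Lemma sumn_le (B : nat) (s : seq nat) :
  {in s, forall x, (x <= B)%N} -> (sumn s <= size s * B)%N.
Proof.
elim: s => //= x s IHs le_B; rewrite mulSn leq_add ?le_B ?mem_head // IHs //.
by move=> y y_s; rewrite le_B // inE y_s orbT.
Qed.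

(** Otherwise [w] and the first [m + 1] entries of [L] would all precede their
    sum; they are distinct since [w] exceeds the bound on the prefix. *)
Lemma shift_precedes (m n w : nat) (L : seq nat) :
    arrangement n L -> ~ has_additive m.+3 L -> (m < n)%N ->
    (small_bound m < w)%N -> (w + sumn (take m.+1 L) <= n)%N ->
  (index (w + sumn (take m.+1 L)) L < index w L)%N.
Proof.
move=> L_arr no_add m_lt; have pre_small := prefix_small m n L L_arr no_add.
have L_size := arrangement_size n L L_arr; case: L_arr => L_uniq L_mem.
set X := take m.+1 L in pre_small *; set v := (w + sumn X)%N => w_large v_le.
have X_size : size X = m.+1 by rewrite size_take_min; lia.
have X_sub : {subset X <= L} by move=> x; exact: mem_take.
have v_L : v \in L by rewrite L_mem; lia.
have w_L : w \in L by rewrite L_mem; lia.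
have w_X : w \notin X by apply/negP => /pre_small; lia.
have v_X : v \notin X by apply/negP => /pre_small; lia.
rewrite ltnNge leq_eqVlt; apply/negP => /orP[/eqP wv|wv].
  (* [w = v] would make the sum of the prefix vanish, but its first entry is a
     positive value. *)
  have : w = v by rewrite -(nth_index 0%N w_L) wv nth_index.
  case X_eq : X X_size => [//|x X'] _.
  have : x \in L by apply: X_sub; rewrite X_eq mem_head.
  by rewrite L_mem /v X_eq /=; lia.
apply: no_add; have -> : m.+3 = (size (w :: X)).+1 by rewrite /= X_size.
apply: (additive_of_earlier_sum _ _ v) => //=.
  by rewrite w_X take_uniq.
move=> x; rewrite inE => /orP[/eqP->|x_X]; first by rewrite w_L.
rewrite X_sub //=; move: v_X; rewrite in_take // -leqNgt; apply: leq_trans.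
by rewrite -in_take // X_sub.
Qed.

(** Infinite descent on positions inside an interval whose length is the sum of
    the two step sizes. With [k = m + 3], the factor [m.*2.+3] is [2 k - 3]. *)
Lemma arrangement_has_additive (m n : nat) (L : seq nat) :
    arrangement n L -> (m.*2.+3 * small_bound m <= n)%N ->
  has_additive m.+3 L.
Proof.
move=> L_arr n_large; apply: NNPP => no_add.
have R_arr := arrangement_rev n L L_arr.
have no_add_rev : ~ has_additive m.+3 (rev L).
  by move=> add; apply: no_add; exact: has_additive_rev.
have m_lt : (m < n)%N by move: n_large; rewrite /small_bound; nia.
have shift_up w := shift_precedes m n w L L_arr no_add m_lt.
have shift_down w := shift_precedes m n w (rev L) R_arr no_add_rev m_lt.
have sum_le M : arrangement n M -> ~ has_additive m.+3 M ->
    (0 < sumn (take m.+1 M) <= m.+1 * small_bound m)%N.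
  move=> M_arr M_no; have := sumn_le _ _ (prefix_small m n M M_arr M_no).
  rewrite size_take_min (arrangement_size n M M_arr).
  have -> : minn m.+1 n = m.+1 by lia.
  move=> ->; rewrite andbT; case: M_arr => _ M_mem.
  case: M M_mem {M_no} => [/(_ 1%N)|x M M_mem]; first by rewrite in_nil; lia.
  by have := M_mem x; rewrite mem_head /=; lia.
have /andP[D1_gt0 D1_le] := sum_le L L_arr no_add.
have /andP[_ D2_le] := sum_le (rev L) R_arr no_add_rev.
move: D1_gt0 D1_le D2_le shift_up shift_down.
set B := small_bound m in n_large *.
set D1 := sumn (take _ L); set D2 := sumn (take _ (rev L)).
move=> D1_gt0 D1_le D2_le shift_up shift_down.
have window_le : (B + D1 + D2 <= n)%N by nia.
case: L_arr => L_uniq L_mem.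
have no_position i u : (B < u <= B + D1 + D2)%N -> index u L <> i.
  elim/ltn_ind: i u => i IHi u u_win u_i.
  case: (leqP (u + D1) (B + D1 + D2)) => u_D1.
    have u_next : (index (u + D1) L < index u L)%N by apply: shift_up; lia.
    by apply: (IHi (index (u + D1)%N L)) erefl; lia.
  have u_next : (index (u - D2 + D2) (rev L) < index (u - D2) (rev L))%N.
    by apply: shift_down; lia.
  have u_L : u \in L by rewrite L_mem; lia.
  have u'_L : (u - D2)%N \in L by rewrite L_mem; lia.
  rewrite subnK in u_next; last by lia.
  rewrite !index_rev // in u_next.
  by apply: (IHi (index (u - D2)%N L)) erefl; lia.
by apply: (no_position (index B.+1 L) B.+1) erefl; lia.
Qed.

Theorem theorem3p3 (k n : nat)
    (hk : (3 <= k)%N)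
    (hn : 9%:R / 4%:R * (k%:R - 2%:R) * (k%:R ^+ 2 - k%:R) ^+ 2 <= n%:R :> rat)
    (p : 'S_n) :
  exists s : seq nat,
    [/\ subseq s (one_line p), size s = k & two_additive s].
Proof.
case: k hk hn => [|[|[|m]]] // _ hn.
have hn_nat : (9 * m.+1 * (m.+3 * m.+2) ^ 2 <= 4 * n)%N.
  rewrite -(ler_nat rat); move: hn.
  rewrite !(natrM, natrX) -(natrM _ _ n).
  have -> : m.+3%:R - 2%:R = m.+1%:R :> rat by rewrite -natrB ?subSS ?subn0.
  have -> : m.+3%:R ^+ 2 - m.+3%:R = m.+3%:R * m.+2%:R :> rat.
    by rewrite -[m.+3 in RHS]addn1 -addn2 -addn1 !natrD; ring.
  by rewrite natrM; lra.
have n_large : (m.*2.+3 * small_bound m <= n)%N.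
  by rewrite /small_bound; nia.
exact: (arrangement_has_additive m n _ (arrangement_one_line n p)).
Qed.
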